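(* The topological space $(\Pi(\mathcal{F}, \tau_{uF}), \tau_{weak})$ is compact (every open cover has a finite subcover). In general it is not Hausdorff and therefore not metrizable; that is, there exists a non-empty locally compact, second-countable Hausdorff space $E$ for which $(\Pi(\mathcal{F}, \tau_{uF}), \tau_{weak})$ is not Hausdorff, and hence not metrizable.
   Context: $(E,\mathcal{G})$ is a non-empty locally compact, second-countable Hausdorff space; $\mathcal{F}$ and $\mathcal{K}$ are the families of all closed and all compact subsets of $E$. For $A\subseteq E$ put $\mathcal{M}(A)=\{F\in\mathcal{F}: F\cap A=\emptyset\}$. The upper Fell topology $\tau_{uF}$ on $\mathcal{F}$ is generated by $\{\mathcal{M}(K):K\in\mathcal{K}\}$. For a topological space $(X,\mathcal{O})$, $\Pi(X,\mathcal{O})$ is the set of all probability measures on the Borel $\sigma$-algebra $\sigma(\mathcal{O})$. The weak topology $\tau_{weak}$ on $\Pi(X,\mathcal{O})$ is the initial topology with respect to the evaluation maps $e_O:P\mapsto P(O)$, $O\in\mathcal{O}$, into $\mathbb{R}$ equipped with the right-order topology $\{(a,\infty):a\in\mathbb{R}\}\cup\{\emptyset,\mathbb{R}\}$. Thus a net $(P_\alpha)$ converges to $P$ in $\tau_{weak}$ iff $\liminf_\alpha P_\alpha(O)\ge P(O)$ for all $O\in\mathcal{O}$. Compactness does not include the Hausdorff property. *)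

(* Defs.v *)
From HB Require Import structures.
From mathcomp Require Import all_boot all_order all_algebra.
From mathcomp Require Import all_classical all_reals all_analysis.

Set Implicit Arguments.
Unset Strict Implicit.
Unset Printing Implicit Defensive.

Import Order.TTheory GRing.Theory Num.Theory.

Local Open Scope classical_set_scope.
Local Open Scope ring_scope.

Definition closed_sets (E : topologicalType) : Type := {F : set E | closed F}.

Definition missing (E : topologicalType) (A : set E) : set (closed_sets E) :=
  [set F | sval F `&` A = set0].

(* [closed_sets E] with the topology having the sets [missing K], K compact, as a subbase *)
Definition upper_fell (E : topologicalType) : Type := closed_sets E.

Section upper_fell_topology.
Variable E : topologicalType.

HB.instance Definition _ := gen_eqMixin (upper_fell E).
HB.instance Definition _ := gen_choiceMixin (upper_fell E).
(* measurable types must be pointed *)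
HB.instance Definition _ := isPointed.Build (upper_fell E) (exist _ set0 closed0).
HB.instance Definition _ := @isSubBaseTopological.Build (upper_fell E)
  (set E) [set K | compact K] (@missing E).

End upper_fell_topology.

(* the topology is [right_order_open] below, not the usual one *)
Definition right_order (R : realType) : Type := R.

Section right_order_topology.
Variable R : realType.

HB.instance Definition _ := Choice.on (right_order R).

Definition right_order_open : set (set (right_order R)) :=
  [set U | [\/ U = set0, U = setT | exists a : R, U = [set x : R | a < x]]].

Let right_order_openT : right_order_open setT.
Proof. by apply: Or32. Qed.

Let right_order_openI : setI_closed right_order_open.
Proof.
move=> U V [->|->|[a ->]]; first by rewrite set0I => _; apply: Or31.
  by rewrite setTI.
move=> [->|->|[b ->]]; first by rewrite setI0; apply: Or31.
  by rewrite setIT; apply: Or33; exists a.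
apply: Or33; exists (Num.max a b); apply/seteqP; split=> x /=.
  by rewrite gt_max => -[-> ->].
by rewrite gt_max => /andP[].
Qed.

Let right_order_open_bigU (I : Type) (f : I -> set (right_order R)) :
  (forall i, right_order_open (f i)) -> right_order_open (\bigcup_i f i).
Proof.
move=> fo.
have [[i fi]|nT] := pselect (exists i, f i = setT).
  apply: Or32; apply/seteqP; split=> // x _.
  by exists i => //; rewrite fi.
pose A : set R := [set a | exists i, f i = [set x : R | a < x]].
have fE : \bigcup_i f i = [set x : R | exists2 a, A a & a < x].
  apply/seteqP; split=> [x [i _]|x [a [i fi] ax]]; last first.
    by exists i => //; rewrite fi.
  have [->//|fi|[a fi]] := fo i; first by case: nT; exists i.
  by rewrite fi => ax; exists a => //; exists i.
have [A0|] := pselect (A !=set0); last first.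
  move=> A0; apply: Or31; rewrite fE -subset0 => x [a Aa _].
  by apply: A0; exists a.
rewrite fE; have [lA|nlA] := pselect (has_lbound A).
  apply: Or33; exists (inf A); apply/seteqP; split=> x.
    by move=> [a Aa ax]; apply: le_lt_trans ax; exact: ge_inf.
  move=> /= /(inf_lt A0)[a Aa ax].
  by exists a.
apply: Or32; apply/seteqP; split=> // x _ /=.
apply: contrapT => nx; apply: nlA; exists x => a Aa.
by rewrite leNgt; apply/negP => ax; apply: nx; exists a.
Qed.

HB.instance Definition _ := isOpenTopological.Build (right_order R)
  right_order_openT right_order_openI right_order_open_bigU.

End right_order_topology.

Definition borel (X : ptopologicalType) := g_sigma_algebraType (@open X).

(* A library measure is a function on all of [set X] that is only constrained on
   measurable sets; its values elsewhere are fixed to 0, so that Leibniz equality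
   is equality of measures on the Borel sigma-algebra. *)
Definition borel_probability (R : realType) (X : ptopologicalType) : Type :=
  {P : probability (borel X) R |
    forall A : set (borel X), ~ measurable A -> P A = 0%E}.

HB.instance Definition _ (R : realType) (X : ptopologicalType) :=
  gen_eqMixin (borel_probability R X).
HB.instance Definition _ (R : realType) (X : ptopologicalType) :=
  gen_choiceMixin (borel_probability R X).

Definition evaluation (R : realType) (X : ptopologicalType) (O : set X)
    (P : borel_probability R X) : right_order R :=
  fine (sval P O).

(* the initial topology for all evaluations [P |-> P O], [O] open *)
Definition weak_probability (R : realType) (X : ptopologicalType) : Type :=
  sup_topology (fun O : {O : set X | open O} =>
    Topological.on (initial_topology (@evaluation R X (sval O)))).

HB.instance Definition _ (R : realType) (X : ptopologicalType) :=
  Topological.on (weak_probability R X).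

Definition metrizable (R : realType) (X : topologicalType) : Prop :=
  exists d : X -> X -> R,
    [/\ forall x, d x x = 0,
        forall x y, d x y = 0 -> x = y,
        forall x y, d x y = d y x,
        forall x y z, d x z <= d x y + d y z &
        forall x, nbhs x =
          filter_from [set e : R | 0 < e] (fun e => [set y | d x y < e])].

(* Main.v *)
Require Import Defs.
From HB Require Import structures.
From mathcomp Require Import all_boot all_order all_algebra finmap.
From mathcomp Require Import all_classical all_reals all_analysis.

(** Both halves rest on one point of the space of probability measures.  The
    closed set [E], viewed as a point of the upper Fell space, misses no
    non-empty compact set, so its only open neighborhood is the whole space.
    Hence the Dirac measure at this point takes the value 0 on every open set
    other than the whole space, where every probability measure takes the
    value 1; it is therefore below every probability measure on all open sets.
    Since the right-order topology only bounds values from below, every weak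
    neighborhood of this Dirac measure contains all probability measures
    ([nbhs_weak_dirac_full]).

    - Compactness: a member of an open cover that contains this Dirac measure
      already covers the whole space.
    - Failure of separation: when [E] has a point [x], the open set of closed
      sets missing [x] distinguishes the Dirac measure at the empty set from the
      one at [E], and yet every neighborhood of the latter contains the former.
      Thus the weak topology is not Hausdorff, for any non-empty [E]. *)

Set Implicit Arguments.
Unset Strict Implicit.
Unset Printing Implicit Defensive.

Import Order.TTheory GRing.Theory Num.Theory.

Local Open Scope classical_set_scope.
Local Open Scope ring_scope.
Local Open Scope fset_scope.

Lemma metrizable_hausdorff (R : realType) (X : topologicalType) :
  metrizable R X -> hausdorff_space X.
Proof.
move=> [d [dxx d0 dC dD nbhsd]] p q clpq; apply: d0; apply/eqP.
have dge0 : 0 <= d p q.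
  by have := dD p q p; rewrite dxx (dC q p) -mulr2n pmulrn_lge0.
rewrite eq_le dge0 andbT leNgt; apply/negP => dgt0.
have ballP x : nbhs x [set y | d x y < d p q / 2].
  by rewrite nbhsd; exists (d p q / 2) => //=; rewrite divr_gt0.
have [z [/= pz qz]] := clpq _ _ (ballP p) (ballP q).
have := le_lt_trans (dD p z q) (ltrD pz _).
by rewrite (dC z q) => /(_ _ qz); rewrite -splitr ltxx.
Qed.

(** In the right-order topology the neighborhoods of a point are closed
    upwards. *)
Lemma nbhs_right_order_le (R : realType) (r s : R) (U : set (right_order R)) :
  r <= s -> nbhs (r : right_order R) U -> U s.
Proof.
move=> rs; rewrite nbhsE => -[V [oV Vr] VU]; apply: VU.
have {}oV : right_order_open V by exact: oV.
case: oV Vr => [->//|->//|[a ->]] /= ar.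
exact: lt_le_trans rs.
Qed.

(** If [Q] is at least [P] on every open set, then every weak neighborhood of
    [P] contains [Q]. *)
Lemma nbhs_weak_le (R : realType) (X : ptopologicalType)
    (P Q : weak_probability R X) (U : set (weak_probability R X)) :
  (forall O : set X, open O -> fine (sval P O) <= fine (sval Q O)) ->
  nbhs P U -> U Q.
Proof.
move=> PQ; suff PcvgQ : principal_filter Q --> P.
  by move=> nU; apply/principal_filterP; exact: PcvgQ.
apply/cvg_sup => -[A oA] V [/= _ [[W oW <-] /= WP] WV].
apply/principal_filterP/WV => /=.
apply: (@nbhs_right_order_le R (fine (sval P A))); first exact: PQ.
exact: open_nbhs_nbhs.
Qed.

Section null_off_measurable.
Local Open Scope ereal_scope.
Context d (T : measurableType d) (R : realType) (P : probability T R).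

(** The function agreeing with [P] on measurable sets and equal to 0 elsewhere;
    this normalization is part of [borel_probability]. *)
Definition null_off_measurable (A : set T) : \bar R :=
  if `[< measurable A >] then P A else 0.

Lemma null_off_measurableE A : measurable A -> null_off_measurable A = P A.
Proof. by rewrite /null_off_measurable => mA; rewrite asboolT. Qed.

Let null0 : null_off_measurable set0 = 0.
Proof. by rewrite null_off_measurableE// measure0. Qed.

Let null_ge0 A : 0 <= null_off_measurable A.
Proof. by rewrite /null_off_measurable; case: ifP. Qed.

Let null_sigma_additive : semi_sigma_additive null_off_measurable.
Proof.
move=> F mF tF mUF; rewrite null_off_measurableE//.
under eq_fun do under eq_bigr do rewrite null_off_measurableE//.
exact: measure_semi_sigma_additive.
Qed.

HB.instance Definition _ := isMeasure.Build _ _ _ null_off_measurable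
  null0 null_ge0 null_sigma_additive.

Let nullT : null_off_measurable setT = 1.
Proof. by rewrite null_off_measurableE// probability_setT. Qed.

HB.instance Definition _ := Measure_isProbability.Build _ _ _
  null_off_measurable nullT.

End null_off_measurable.

Lemma null_off_measurable_eq0 d (T : measurableType d) (R : realType)
    (P : probability T R) (A : set T) :
  ~ measurable A -> null_off_measurable P A = 0%E.
Proof. by rewrite /null_off_measurable => /asboolPn/negbTE ->. Qed.

(** The Dirac measure at [x] as a Borel probability measure. *)
Definition weak_dirac (R : realType) (X : ptopologicalType) (x : X) :
    weak_probability R X :=
  exist _ (null_off_measurable (\d_(x : borel X)) : probability (borel X) R)
    (@null_off_measurable_eq0 _ (borel X) R _).

Lemma open_borel (X : ptopologicalType) (O : set X) :
  open O -> measurable (O : set (borel X)).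
Proof. by move=> oO; apply: sub_sigma_algebra. Qed.

Lemma weak_diracE (R : realType) (X : ptopologicalType) (x : X) (O : set X) :
  open O -> sval (weak_dirac R x) O = ((x \in O)%:R)%:E.
Proof.
by move=> oO; rewrite /= null_off_measurableE ?diracE//; exact: open_borel.
Qed.

(** If the only open set containing [x] is the whole space, then so is the only
    weak neighborhood of the Dirac measure at [x]. *)
Lemma nbhs_weak_dirac (R : realType) (X : ptopologicalType) (x : X)
    (U : set (weak_probability R X)) :
  (forall O, open O -> O x -> O = setT) ->
  nbhs (weak_dirac R x) U -> U = setT.
Proof.
move=> xT nU; apply/seteqP; split=> // Q _.
apply: nbhs_weak_le nU => O oO; rewrite weak_diracE//=.
have [xO|_] := boolP (x \in O); last exact: fine_ge0.
rewrite inE in xO; rewrite (xT O)//.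
by have -> : sval Q setT = 1%E by exact: probability_setT.
Qed.

(** The closed sets [E] and the empty set, as points of the upper Fell space. *)
Definition full_set (E : topologicalType) : upper_fell E :=
  exist _ [set: E] closedT.

Definition empty_set (E : topologicalType) : upper_fell E :=
  exist _ (@set0 E) closed0.

Lemma open_missing (E : topologicalType) (K : set E) :
  compact K -> open (missing K : set (upper_fell E)).
Proof.
move=> cK; exists [set missing K]; last by rewrite bigcup_set1.
move=> _ ->; exists [fset K]; first by move=> L /fset1P ->; rewrite inE.
by rewrite set_fset1 bigcap_set1.
Qed.

Lemma open_full_set (E : topologicalType) (O : set (upper_fell E)) :
  open O -> O (full_set E) -> O = setT.
Proof.
move=> -[B Bfin <-] [A BA Afull].
have [KS _ AE] := Bfin _ BA.
apply/seteqP; split=> // F _; exists A => //.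
rewrite -AE in Afull *.
(* a compact set disjoint from the closed set [E] is empty *)
move=> K /Afull; rewrite /= /missing /= setTI => ->.
by rewrite setI0.
Qed.

Lemma nbhs_weak_dirac_full (R : realType) (E : topologicalType)
    (U : set (weak_probability R (upper_fell E))) :
  nbhs (weak_dirac R (full_set E)) U -> U = setT.
Proof. exact/nbhs_weak_dirac/open_full_set. Qed.

Lemma weak_upper_fell_cover_compact (R : realType) (E : topologicalType) :
  cover_compact [set: weak_probability R (upper_fell E)].
Proof.
move=> I D f fo cov; have [i Di fi] := cov (weak_dirac R (full_set E)) Logic.I.
exists [fset i]; first by move=> j /fset1P ->; rewrite inE.
have fiT : f i = setT.
  by apply: nbhs_weak_dirac_full; apply: open_nbhs_nbhs; split=> //; exact: fo.
by move=> Q _; exists i; rewrite /= ?inE// fiT.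
Qed.

Lemma weak_upper_fell_not_hausdorff (R : realType) (E : topologicalType) :
  [set: E] !=set0 -> ~ hausdorff_space (weak_probability R (upper_fell E)).
Proof.
move=> [x _] hX.
have : weak_dirac R (full_set E) = weak_dirac R (empty_set E).
  apply: hX => A B /nbhs_weak_dirac_full -> /nbhs_singleton Be.
  by exists (weak_dirac R (empty_set E)).
pose at_missing (P : borel_probability R (upper_fell E)) :=
  sval P (missing [set x]).
move=> /(congr1 at_missing); rewrite /at_missing.
rewrite !weak_diracE; do ?exact/open_missing/compact_set1.
rewrite (@memNset _ _ (full_set E)); last first.
  by rewrite /missing /= setTI => /seteqP[/(_ x) + _]; apply.
rewrite mem_set; last by rewrite /missing /= set0I.
by move=> [] /esym/eqP; rewrite oner_eq0.
Qed.

Lemma locally_compact_compactT (E : topologicalType) :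
  compact [set: E] -> locally_compact [set: E].
Proof.
move=> cE x _; exists setT; first exact: filterT.
by split=> //; exact: closedT.
Qed.

Theorem corollary2 (R : realType) :
  (forall E : topologicalType,
     [set: E] !=set0 -> locally_compact [set: E] -> @second_countable E ->
     hausdorff_space E ->
     cover_compact [set: weak_probability R (upper_fell E)])
  /\
  (exists E : topologicalType,
     ([set: E] !=set0 /\ locally_compact [set: E] /\ @second_countable E /\
      hausdorff_space E) /\
     ~ hausdorff_space (weak_probability R (upper_fell E)) /\
     ~ metrizable R (weak_probability R (upper_fell E))).
Proof.
split=> [E _ _ _ _|]; first exact: weak_upper_fell_cover_compact.
have bool0 : [set: bool] !=set0 by exists true.
have nH := @weak_upper_fell_not_hausdorff R bool bool0.
exists bool; split; last by split=> // /metrizable_hausdorff.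
split; first exact: bool0.
split; first exact/locally_compact_compactT/bool_compact.
split; last exact: discrete_hausdorff.
exact: (@compact_second_countable R bool bool_compact).
Qed.
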